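(* Fix a complex number $a$. Let $(x_n)_{n\ge 0}$ be a sequence of complex numbers satisfying $x_{n+2}=ax_{n+1}-x_n$ for every integer $n\ge 0$, and let $(u_n)_{n\ge 0}$ be the sequence satisfying the same recurrence $u_{n+2}=au_{n+1}-u_n$ for every $n\ge 0$ with $u_0=0$ and $u_1=1$. For every integer $n\ge 1$ let $S_n=\sum_{k=0}^{n-1}x_k$. Then for every positive odd integer $n$, $$S_n=\bigl(u_{(n+1)/2}+u_{(n-1)/2}\bigr)\,x_{(n-1)/2}.$$ *)

(* Defs.v *)
From mathcomp Require Import all_boot all_order all_algebra.
From mathcomp Require Import reals complex.

Set Implicit Arguments.
Unset Strict Implicit.
Unset Printing Implicit Defensive.

Import Order.TTheory GRing.Theory Num.Theory.

Local Open Scope ring_scope.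

(* R[i] is the field of complex numbers over the reals R. *)
Definition recurrence (R : realType) (a : R[i]) (x : nat -> R[i]) : Prop :=
  forall n : nat, x n.+2 = a * x n.+1 - x n.

(* Main.v *)
Require Import Defs.
From mathcomp Require Import all_boot all_order all_algebra.
From mathcomp Require Import reals complex.
From mathcomp Require Import ring.

(** The recurrence is symmetric under reversing the index, so two terms placed
    symmetrically around a centre [c] add up to a multiple of [x c] that depends
    only on their distance [d] to the centre:
      x (c + d) + x (c - d) = (u (d + 1) - u (d - 1)) * x c.
    This is the sum of the two expressions of [x (c + d)] and [x (c - d)] in
    terms of [x c] and [x (c + 1)], in which the contributions of [x (c + 1)]
    cancel ([recurrence_shift], [recurrence_unshift], [recurrence_mirror]).
    A sum of an odd number of consecutive terms groups into such pairs around
    its middle term, and the coefficients 1 + \sum_(1 <= d <= m)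
    (u (d + 1) - u (d - 1)) telescope to u (m + 1) + u m
    ([sum_odd_window]). *)

Set Implicit Arguments.
Unset Strict Implicit.
Unset Printing Implicit Defensive.

Import Order.TTheory GRing.Theory Num.Theory.

Local Open Scope ring_scope.

Lemma recurrence_shift (R : realType) (a : R[i]) (x u : nat -> R[i]) :
    recurrence a x -> recurrence a u -> u 0%N = 0 -> u 1%N = 1 ->
  forall i j, x (i + j).+1 = u j.+1 * x i.+1 - u j * x i.
Proof.
move=> hx hu u0 u1 i j; elim: j i => [|j IHj] i.
  by rewrite addn0 u0 u1; ring.
by rewrite addnS -addSn IHj hx (hu j); ring.
Qed.

(** The pair ([x (i + j)], [x (i + j).+1]) determines the earlier terms because
    the recurrence, solved for its oldest term, is the same recurrence read
    backwards. *)
Lemma recurrence_unshift (R : realType) (a : R[i]) (x u : nat -> R[i]) :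
    recurrence a x -> recurrence a u -> u 0%N = 0 -> u 1%N = 1 ->
  forall i j, x i = u j.+1 * x (i + j)%N - u j * x (i + j).+1.
Proof.
move=> hx hu u0 u1 i; elim=> [|j IHj].
  by rewrite addn0 u0 u1; ring.
by rewrite addnS hx (hu j) {1}IHj; ring.
Qed.

Lemma recurrence_mirror (R : realType) (a : R[i]) (x u : nat -> R[i]) :
    recurrence a x -> recurrence a u -> u 0%N = 0 -> u 1%N = 1 ->
  forall i j, x i + x (i + j.*2.+2)%N = (u j.+2 - u j) * x (i + j.+1)%N.
Proof.
move=> hx hu u0 u1 i j.
rewrite {1}(recurrence_unshift hx hu u0 u1 i j.+1).
have -> : (i + j.*2.+2)%N = ((i + j.+1) + j).+1.
  by rewrite -addnn -addnA addSn !addnS.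
by rewrite (recurrence_shift hx hu u0 u1 (i + j.+1) j); ring.
Qed.

(** The starting index [i] is free so that the induction can strip the two end
    terms of the window: what remains starts at [i.+1] and has the same
    centre. *)
Lemma sum_odd_window (R : realType) (a : R[i]) (x u : nat -> R[i]) :
    recurrence a x -> recurrence a u -> u 0%N = 0 -> u 1%N = 1 ->
  forall m i,
    \sum_(0 <= k < m.*2.+1) x (i + k)%N = (u m.+1 + u m) * x (i + m)%N.
Proof.
move=> hx hu u0 u1; elim=> [|m IHm] i.
  by rewrite big_nat1 u0 u1; ring.
rewrite doubleS big_nat_recl // big_nat_recr //= addn0.
under eq_bigr do rewrite addnS -addSn.
rewrite IHm addSn -addnS addrCA (recurrence_mirror hx hu u0 u1); ring.
Qed.

Theorem theorem4 (R : realType) (a : R[i]) (x u S : nat -> R[i])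
  (hx : recurrence a x)
  (hu : recurrence a u) (hu0 : u 0%N = 0) (hu1 : u 1%N = 1)
  (hS : forall n : nat, (1 <= n)%N -> S n = \sum_(0 <= k < n) x k)
  (n : nat) (hn : (0 < n)%N) (hodd : odd n) :
  S n = (u ((n + 1) %/ 2)%N + u ((n - 1) %/ 2)%N) * x ((n - 1) %/ 2)%N.
Proof.
rewrite hS // -(odd_double_half n) hodd add1n; move: n./2 => m.
rewrite addn1 subn1 -doubleS /= !divn2 !doubleK.
exact: (sum_odd_window hx hu hu0 hu1 m 0).
Qed.
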